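(* Let $M$ be an $n\times n$ symmetric matrix over $\mathbb{GF}(2)$ with rows and columns indexed by a finite set $V$. Let $u,v\in V$ be distinct and $V'=V\setminus\{u,v\}$. Suppose that $$M=\begin{bmatrix}1&1&P^T\\1&1&Q^T\\P&Q&N\end{bmatrix},$$ where the block rows and block columns are indexed by $\{u\}$, $\{v\}$ and $V'$. Then $$\begin{aligned}P_{\langle\delta\tau\delta\rangle}(M,z)=&-z^{\operatorname{rank}(M)-\operatorname{rank}(N)}P_{\langle\delta\tau\delta\rangle}(N,z)+z^{\operatorname{rank}(M)-\operatorname{rank}(L)}P_{\langle\delta\tau\delta\rangle}(L,z)\\&+z^{\operatorname{rank}(M)-\operatorname{rank}(M_v)}P_{\langle\delta\tau\delta\rangle}(M_v,z)+z^{\operatorname{rank}(M)-\operatorname{rank}(M_u)}P_{\langle\delta\tau\delta\rangle}(M_u,z),\end{aligned}$$ where $M_u=M[V\setminus\{u\}]$, $M_v=M[V\setminus\{v\}]$ and $L=N+PQ^T+QP^T$.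
   Context: All matrices are over $\mathbb{GF}(2)$. For a square matrix $C$ with rows and columns indexed by a finite set $W$, the partial-$\langle\delta\tau\delta\rangle$ polynomial of $C$ is $$P_{\langle\delta\tau\delta\rangle}(C,z)=\sum_{A\subseteq W}z^{\operatorname{rank}(C)-\operatorname{corank}((C+I_A)[A])},$$ where $I_A$ is the diagonal matrix indexed by $W$ with diagonal entry $1$ at indices in $A$ and $0$ otherwise, $C[A]$ denotes the principal submatrix of $C$ on $A$, and the corank of a $k\times k$ matrix is $k$ minus its rank. The empty matrix has rank and corank $0$ (so its polynomial is $1$). The matrices $N$ and $L$ are indexed by $V'$. Polynomials have integer coefficients, and identities are understood in the ring of Laurent polynomials in $z$. *)

(* Defs.v *)
From HB Require Import structures.
From mathcomp Require Import all_boot all_order all_algebra.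

Set Implicit Arguments.
Unset Strict Implicit.
Unset Printing Implicit Defensive.

Import GRing.Theory.

Local Open Scope ring_scope.

Definition sqmx (W : finType) : Type := W -> W -> 'F_2.

Definition symmetric_sqmx (W : finType) (C : sqmx W) : Prop :=
  forall x y : W, C x y = C y x.

(* The enumeration of W only serves to reuse the library rank; the rank does
   not depend on it. *)
Definition sqmx_rank (W : finType) (C : sqmx W) : nat :=
  \rank (\matrix_(i < #|W|, j < #|W|) C (enum_val i) (enum_val j)).

Definition sqmx_corank (W : finType) (C : sqmx W) : nat :=
  (#|W| - sqmx_rank C)%N.

Definition sqmx_add (W : finType) (C D : sqmx W) : sqmx W :=
  fun x y => C x y + D x y.

(* The matrix I_A. *)
Definition diag_set (W : finType) (A : {set W}) : sqmx W :=
  fun x y => ((x == y) && (x \in A))%:R.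

(* The matrix P Q^T, for column vectors P and Q. *)
Definition outer (W : finType) (P Q : W -> 'F_2) : sqmx W :=
  fun x y => P x * Q y.

Definition elt_of (W : finType) (A : {set W}) : finType := {x : W | x \in A}.

(* The principal submatrix C[A]. *)
Definition principal (W : finType) (C : sqmx W) (A : {set W}) :
    sqmx (elt_of A) :=
  fun x y => C (val x) (val y).
Arguments principal {W} C A _ _.

(* Laurent polynomials in z with integer coefficients are handled inside the
   fraction field of Z[z], of which Z[z, z^-1] is a subring; this makes
   [zvar ^ k] available for every k : int. *)
Definition zvar : {fraction {poly int}} := tofrac 'X.

(* The partial-<delta tau delta> polynomial of C. The exponents are computed
   in int, so that the subtraction is not truncated. *)
Definition partial_dtd (W : finType) (C : sqmx W) : {fraction {poly int}} :=
  \sum_(A : {set W})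
    zvar ^ ((sqmx_rank C)%:Z
            - (sqmx_corank (principal (sqmx_add C (diag_set A)) A))%:Z).

(* Main.v *)
(* After division by z^rank(M), each polynomial is a sum of z^-corank over
   principal submatrices of M, or of the pivoted matrix K extending L, indexed
   by subsets of V. Group the subsets of V by their trace B on V'. Since the
   diagonal entries of M at u and v are 1, a Schur complement identifies the
   corank of (M + I)[B + u + v] with that of (L + I)[B]. The other three terms
   of each group, for B, B + u and B + v, are those of M_v and M_u, with the
   term for B counted twice, whence the correction by N. *)

Require Import Defs.
From HB Require Import structures.
From mathcomp Require Import all_boot all_order all_algebra.

Set Implicit Arguments.
Unset Strict Implicit.
Unset Printing Implicit Defensive.

Import GRing.Theory.

Local Open Scope ring_scope.

(** Block elimination: unitriangular factors on both sides leave the diagonal blocks [A] and its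
    Schur complement. *)
Lemma mxrank_Schur (F : fieldType) (m n : nat) (A : 'M[F]_m) (B : 'M[F]_(m, n))
    (C : 'M[F]_(n, m)) (D : 'M[F]_n) :
  A \in unitmx ->
  \rank (block_mx A B C D) = (m + \rank (D - C *m invmx A *m B)%R)%N.
Proof.
move=> Au; set S := D - _.
have -> : block_mx A B C D
    = block_mx 1%:M 0 (C *m invmx A) 1%:M *m block_mx A 0 0 S
      *m block_mx 1%:M (invmx A *m B) 0 1%:M.
  rewrite !mulmx_block !(mul1mx, mulmx1, mul0mx, mulmx0, addr0, add0r).
  by rewrite mulKVmx // mulmxKV // mulmxA [S]/(D - _) addrC subrK.
rewrite mxrankMfree; last first.
  by rewrite row_free_unit unitmxE det_ublock !det1 mul1r unitr1.
rewrite (eqmxMfull (block_mx A 0 0 S)); last first.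
  by rewrite row_full_unit unitmxE det_lblock !det1 mul1r unitr1.
by rewrite rank_diag_block_mx mxrank_unit.
Qed.

Lemma mxrank_mxsub (F : fieldType) (m n p q : nat) (f : 'I_p -> 'I_m)
    (g : 'I_q -> 'I_n) (A : 'M[F]_(m, n)) :
  (\rank (mxsub f g A) <= \rank A)%N.
Proof.
have rowsub_le k l r (h : 'I_k -> 'I_l) (B : 'M[F]_(l, r)) :
    (\rank (rowsub h B) <= \rank B)%N by apply/mxrankS/rowsub_sub.
rewrite mxsubrc; apply: leq_trans (rowsub_le _ _ _ _ _) _.
by rewrite -mxrank_tr -[leqRHS]mxrank_tr trmx_mxsub rowsub_le.
Qed.

(** Choosing [h] with [f i = g (h i)] exhibits the left matrix as a selection, possibly with
    repetitions, of rows and columns of the right one. *)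
Lemma mxrank_index_sub (F : fieldType) (T : Type) (m n : nat) (f : 'I_m -> T)
    (g : 'I_n -> T) (C : T -> T -> F) :
  (forall i, exists j, f i = g j) ->
  (\rank (\matrix_(i, j) C (f i) (f j)) <= \rank (\matrix_(i, j) C (g i) (g j)))%N.
Proof.
move=> /(@fin_all_exists _ (fun=> 'I_n)) [h fE].
have -> : \matrix_(i, j) C (f i) (f j)
    = mxsub h h (\matrix_(i, j) C (g i) (g j)).
  by apply/matrixP=> i j; rewrite !mxE !fE.
exact: mxrank_mxsub.
Qed.

Lemma mxrank_index (F : fieldType) (T : Type) (m n : nat) (f : 'I_m -> T)
    (g : 'I_n -> T) (C : T -> T -> F) :
  (forall i, exists j, f i = g j) -> (forall j, exists i, g j = f i) ->
  \rank (\matrix_(i, j) C (f i) (f j)) = \rank (\matrix_(i, j) C (g i) (g j)).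
Proof.
by move=> fg gf; apply/eqP; rewrite eqn_leq !mxrank_index_sub.
Qed.

(** Frees the rank from the canonical enumeration, so that a convenient ordering of [A] can be
    used. *)
Lemma sqmx_rank_principal (W : finType) (C : sqmx W) (A : {set W}) (n : nat)
    (h : 'I_n -> W) :
  (forall i, h i \in A) -> (forall x, x \in A -> exists i, x = h i) ->
  sqmx_rank (principal C A) = \rank (\matrix_(i, j) C (h i) (h j)).
Proof.
move=> hA Ah.
rewrite /sqmx_rank /principal (@mxrank_index _ _ _ _ (fun i => val (enum_val i)) h) //.
- by move=> i; apply/Ah/valP.
- move=> j; exists (enum_rank (Sub (h j) (hA j) : elt_of A)).
  by rewrite enum_rankK SubK.
Qed.

Lemma sqmx_rank_principal_enum (W : finType) (C : sqmx W) (A : {set W}) :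
  sqmx_rank (principal C A)
    = \rank (\matrix_(i < #|A|, j < #|A|) C (enum_val i) (enum_val j)).
Proof.
apply: sqmx_rank_principal => [i|x Ax]; first exact: enum_valP.
by exists (enum_rank_in Ax x); rewrite enum_rankK_in.
Qed.

Definition dtd_corank (W : finType) (C : sqmx W) (A : {set W}) : nat :=
  sqmx_corank (principal (sqmx_add C (diag_set A)) A).

Lemma sqmx_corank_principal (W : finType) (C : sqmx W) (A : {set W}) :
  sqmx_corank (principal C A) = (#|A| - sqmx_rank (principal C A))%N.
Proof. by rewrite /sqmx_corank card_sig. Qed.

Lemma dtd_corank_imset (W U : finType) (f : W -> U) (C : sqmx W) (D : sqmx U)
    (A : {set W}) :
  injective f -> (forall x y, C x y = D (f x) (f y)) ->
  dtd_corank C A = dtd_corank D (f @: A).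
Proof.
move=> f_inj CD; rewrite /dtd_corank !sqmx_corank_principal card_imset //.
rewrite sqmx_rank_principal_enum; congr (_ - _)%N.
rewrite (@sqmx_rank_principal _ _ _ _ (fun i : 'I_#|A| => f (enum_val i))).
- congr (\rank _); apply/matrixP=> i j.
  by rewrite !mxE /sqmx_add /diag_set CD (inj_eq f_inj) mem_imset.
- by move=> i; rewrite imset_f ?enum_valP.
- move=> _ /imsetP[x Ax ->].
  by exists (enum_rank_in Ax x); rewrite enum_rankK_in.
Qed.

Lemma zvar_neq0 : zvar != 0.
Proof. by rewrite tofrac_eq0 polyX_eq0. Qed.

(** Brings polynomials of matrices with different index types to sums over subsets of one set [U].
    The prefactor replaces the rank of [C] by the common exponent [r]. *)
Lemma partial_dtd_imset (W U : finType) (f : W -> U) (C : sqmx W) (D : sqmx U)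
    (S : {set U}) (r : int) :
  injective f -> (forall x y, C x y = D (f x) (f y)) -> f @: [set: W] = S ->
  zvar ^ (r - (sqmx_rank C)%:Z) * partial_dtd C
    = \sum_(B : {set U} | B \subset S) zvar ^ (r - (dtd_corank D B)%:Z).
Proof.
move=> f_inj CD fS; rewrite /partial_dtd big_distrr /=.
rewrite (reindex_onto (fun A : {set W} => f @: A) (fun B => f @^-1: B)) /=.
  apply: eq_big => [A | A _].
    have -> : f @^-1: (f @: A) = A.
      by apply/setP=> x; rewrite inE mem_imset.
    by rewrite eqxx -fS imsetS ?subsetT.
  by rewrite -expfzDr ?zvar_neq0 // subrKA -(dtd_corank_imset A f_inj CD).
move=> B; rewrite -fS => /subsetP BS; apply/setP=> y.
apply/imsetP/idP => [[x] | By]; first by rewrite inE => ? ->.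
by have /imsetP[x _ yE] := BS y By; exists x; rewrite // inE -yE.
Qed.

Lemma partial_dtd_id (W : finType) (D : sqmx W) :
  partial_dtd D = \sum_(B : {set W} | B \subset [set: W])
    zvar ^ ((sqmx_rank D)%:Z - (dtd_corank D B)%:Z).
Proof. by apply: eq_bigl => B; rewrite subsetT. Qed.

Lemma imset_val_elt_of (U : finType) (S : {set U}) :
  (val : elt_of S -> U) @: [set: elt_of S] = S.
Proof.
apply/setP=> x; apply/imsetP/idP => [[y _ ->]|Sx]; first exact: valP.
by exists (Sub x Sx); rewrite ?inE ?SubK.
Qed.

Lemma big_subset_setD1 (U : finType) (T : nmodType) (S : {set U}) (u : U)
    (g : {set U} -> T) :
  u \in S ->
  \sum_(B : {set U} | B \subset S) g B
    = \sum_(B : {set U} | B \subset S :\ u) (g B + g (u |: B)).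
Proof.
move=> Su; rewrite big_split (bigID (fun B : {set U} => u \notin B)) /=.
congr (_ + _); first by apply: eq_bigl => B; rewrite subsetD1.
rewrite (reindex_onto (fun B => u |: B) (fun B => B :\ u)) /=; last first.
  by move=> B /andP[_ /negPn uB]; rewrite setD1K.
apply: eq_bigl => B; rewrite subsetD1 setU11 subUset sub1set Su /= andbT.
congr (_ && _); apply/eqP/idP => [<- | uB]; first by rewrite !inE eqxx.
exact: setU1K.
Qed.

(* Pivoting on the block of (M + I)[u, v], which is the exchange matrix
   [[0, 1], [1, 0]], turns the other block into the update below. *)
Lemma dtd_corank_pivot (V : finType) (M : sqmx V) (u v : V) (B : {set V}) :
  u != v -> M u u = 1 -> M u v = 1 -> M v u = 1 -> M v v = 1 ->
  u \notin B -> v \notin B ->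
  dtd_corank M (u |: (v |: B))
    = dtd_corank (fun x y => M x y + M x u * M v y + M x v * M u y) B.
Proof.
move=> uv Muu Muv Mvu Mvv uB vB.
rewrite /dtd_corank !sqmx_corank_principal [in RHS]sqmx_rank_principal_enum.
(* List [u] and [v] first, so that the pivot block is the upper left one. *)
pose h (i : 'I_(2 + #|B|)) : V := match split i with
  | inl j => if j == 0 then u else v
  | inr k => enum_val k end.
have hl j : h (lshift _ j) = if j == 0 then u else v.
  by rewrite /h -[lshift _ j]/(unsplit (inl j)) unsplitK.
have hr k : h (rshift _ k) = enum_val k.
  by rewrite /h -[rshift _ k]/(unsplit (inr k)) unsplitK.
have neq_u (k : 'I_#|B|) : (u == enum_val k) = false.
  by apply: contraNF uB => /eqP->; apply: enum_valP.
have neq_v (k : 'I_#|B|) : (v == enum_val k) = false.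
  by apply: contraNF vB => /eqP->; apply: enum_valP.
rewrite cardsU1 cardsU1 vB !inE (negPf uv) (negPf uB) addnA /=.
rewrite (@sqmx_rank_principal _ _ _ _ h); last first.
- move=> x; rewrite !inE => /or3P[/eqP->|/eqP->|Bx].
  + by exists (lshift _ 0); rewrite hl.
  + by exists (lshift _ 1); rewrite hl.
  + by exists (rshift _ (enum_rank_in Bx x)); rewrite hr enum_rankK_in.
- move=> i; case: (split_ordP i) => [j|k] ->; rewrite ?hl ?hr.
    by case: ifP => _; rewrite !inE eqxx ?orbT.
  by rewrite !inE enum_valP !orbT.
set X := (\matrix_(i, j) _ : 'M_(2 + _)).
pose J : 'M['F_2]_2 := \matrix_(i, j) (i != j)%:R.
have JJ : J *m J = 1%:M.
  apply/matrixP=> i j; rewrite !mxE big_ord_recl big_ord1 !mxE.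
  by case: i j => [[|[|i]] ?] [[|[|j]] ?] //=; rewrite ?mulr0 ?mul0r ?mulr1 ?addr0 ?add0r.
have Ju : J \in unitmx by have [] := mulmx1_unit JJ.
have -> : X = block_mx J (ursubmx X) (dlsubmx X) (drsubmx X).
  rewrite -[LHS](submxK X); congr block_mx.
  (* On the diagonal of the pivot block, the entry 1 of [M] and that of the added identity
     cancel. *)
  apply/matrixP=> i j; rewrite !mxE !hl /sqmx_add /diag_set !inE.
  case: i j => [[|[|i]] ?] [[|[|j]] ?] //=;
    rewrite ?(Muu, Muv, Mvu, Mvv) ?(eq_sym v u) ?eqxx ?(negPf uv) ?addr0 //=;
    exact: addrr_pchar2.
(* The pivot block has rank 2, which offsets the two extra indices in the corank. *)
rewrite (mxrank_Schur _ _ _ Ju) subnDl.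
have -> : invmx J = J by rewrite -[RHS]mul1mx -(mulVmx Ju) -mulmxA JJ mulmx1.
(* Since [J] swaps [u] and [v], the Schur complement subtracts [M x u * M v y + M x v * M u y]; in
   characteristic 2 this is an addition. *)
congr (_ - \rank _)%N; apply/matrixP=> i j; rewrite !mxE !big_ord_recl !big_ord0.
rewrite !mxE !big_ord_recl !big_ord0 !mxE !hl !hr /= /sqmx_add /diag_set.
rewrite !(eq_sym (enum_val _) u) !(eq_sym (enum_val _) v) !(neq_u, neq_v).
rewrite !inE !(eq_sym (enum_val _) u) !(eq_sym (enum_val _) v) !(neq_u, neq_v).
rewrite oppr_pchar2 //= !(mulr0, mulr1, addr0, add0r).
by rewrite -!addrA; congr (_ + _); rewrite addrC -addrA addrCA.
Qed.

Theorem theorem4p3 (V : finType) (M : sqmx V) (u v : V)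
    (V' : {set V} := [set: V] :\: [set u; v])
    (P Q : elt_of V' -> 'F_2) (N : sqmx (elt_of V'))
    (L : sqmx (elt_of V') := sqmx_add (sqmx_add N (outer P Q)) (outer Q P))
    (Mu := principal M ([set: V] :\ u))
    (Mv := principal M ([set: V] :\ v))
    (M_sym : symmetric_sqmx M)
    (u_neq_v : u != v)
    (Muu : M u u = 1) (Muv : M u v = 1) (Mvu : M v u = 1) (Mvv : M v v = 1)
    (MuP : forall x : elt_of V', M u (val x) = P x)
    (MvQ : forall x : elt_of V', M v (val x) = Q x)
    (MPu : forall x : elt_of V', M (val x) u = P x)
    (MQv : forall x : elt_of V', M (val x) v = Q x)
    (MN : forall x y : elt_of V', M (val x) (val y) = N x y) :
  partial_dtd M =
    - (zvar ^ ((sqmx_rank M)%:Z - (sqmx_rank N)%:Z) * partial_dtd N)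
    + zvar ^ ((sqmx_rank M)%:Z - (sqmx_rank L)%:Z) * partial_dtd L
    + zvar ^ ((sqmx_rank M)%:Z - (sqmx_rank Mv)%:Z) * partial_dtd Mv
    + zvar ^ ((sqmx_rank M)%:Z - (sqmx_rank Mu)%:Z) * partial_dtd Mu.
Proof.
set V2 := [set: V] :\ u :\ v.
have V'E : V' = V2 by apply/setP=> x; rewrite !inE; case: (x == u); case: (x == v).
have V'E2 : [set: V] :\ v :\ u = V2 by apply/setP=> x; rewrite !inE andbCA.
have fV' : (val : elt_of V' -> V) @: setT = V2 by rewrite imset_val_elt_of V'E.
(* The matrix produced by [dtd_corank_pivot]; on [V'] its two extra terms are the entries of
   [outer P Q] and [outer Q P]. *)
pose K : sqmx V := fun x y => M x y + M x u * M v y + M x v * M u y.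
have KL x y : L x y = K (val x) (val y).
  by rewrite /K /L /sqmx_add /outer MN MPu MvQ MQv MuP.
have NM x y : N x y = M (val x) (val y) by rewrite MN.
have uS : u \in [set: V] :\ v by rewrite !inE u_neq_v.
have vS : v \in [set: V] :\ u by rewrite !inE eq_sym u_neq_v.
rewrite (partial_dtd_imset _ val_inj NM fV') (partial_dtd_imset _ val_inj KL fV').
rewrite (partial_dtd_imset (D := M) _ val_inj _ (imset_val_elt_of _)) //.
rewrite (partial_dtd_imset (D := M) _ val_inj _ (imset_val_elt_of _)) //.
rewrite partial_dtd_id.
(* Split the sum for [M] on [u] and then [v], the one for [Mv] on [u] and the one for [Mu] on [v];
   all sums then range over subsets of [V2]. *)
rewrite (big_subset_setD1 _ (in_setT u)) (big_subset_setD1 _ uS).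
rewrite !(big_subset_setD1 _ vS) V'E2 -!sumrN -!big_split /=; apply: eq_bigr => B.
rewrite !subsetD1 => /andP[/andP[_ uB] vB].
rewrite dtd_corank_pivot // -/K.
(* These are the terms of [M] for [B], [u |: B], [v |: B] and [u |: (v |: B)], the last one
   rewritten through [K]. It remains that [a + b + (c + d)] equals [- a + d + (a + b) + (a + c)]. *)
set a := zvar ^ _; set b := zvar ^ _; set c := zvar ^ _; set d := zvar ^ _.
have -> : - a + d + (a + b) = b + d by rewrite addrACA addNr add0r addrC.
by rewrite [RHS]addrC addrACA.
Qed.
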